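(* Let $f=\frac1N\sum_{j=1}^N f_j$ on the Riemannian manifold $\mathcal M$ satisfy the retraction smoothness assumption with constant $L_r>0$ and the bounded variance estimator assumption with constant $\sigma>0$ (both stated in the context). Let $0\le\eta_{\min}\le\eta_{\max}<\frac{2}{L_r}$ with $\eta_{\max}>0$, let $p>0$, and let the batch size be constant, $b_t=b>0$ for all $t$. For a total number of iterations $T\ge 1$, let $(x_t)_t$ be generated by RSGD with one of the following learning rates, for $t\in\{0,\dots,T-1\}$: (1) constant: $\eta_t=\eta_{\max}$; (2) diminishing: $\eta_t=\frac{\eta_{\max}}{\sqrt{t+1}}$; (3) cosine annealing: $\eta_t=\eta_{\min}+\frac{\eta_{\max}-\eta_{\min}}{2}\left(1+\cos\frac{t}{T}\pi\right)$; (4) polynomial decay: $\eta_t=\eta_{\min}+(\eta_{\max}-\eta_{\min})\left(1-\frac tT\right)^p$. Then there are constants $Q_1,Q_2,\tilde Q_1,\tilde Q_2$ that do not depend on $T$ such that: for the diminishing learning rate (2), $$\min_{t\in\{0,\dots,T-1\}}\mathbb E\left[\|\mathrm{grad}f(x_t)\|_{x_t}^2\right]\le\frac{Q_1+Q_2\sigma^2b^{-1}\log T}{\sqrt T}=O\left(\frac{\log T}{\sqrt T}\right);$$ for each of the learning rates (1), (3), (4), $$\min_{t\in\{0,\dots,T-1\}}\mathbb E\left[\|\mathrm{grad}f(x_t)\|_{x_t}^2\right]\le\frac{\tilde Q_1}{T}+\frac{\tilde Q_2\sigma^2}{b}=O\left(\frac1T+\frac1b\right).$$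
   Context: $\mathcal M$ is a Riemannian manifold with inner product $\langle\cdot,\cdot\rangle_x$ and norm $\|\cdot\|_x$ on the tangent space $T_x\mathcal M$; $\mathrm{grad}$ denotes the Riemannian gradient. A retraction is a map $R\colon T\mathcal M\ni(x,v)\mapsto R_x(v)\in\mathcal M$ with $R_x(0_x)=x$ and $DR_x(0_x)=\mathrm{id}_{T_x\mathcal M}$ (identifying $T_{0_x}T_x\mathcal M\simeq T_x\mathcal M$) for all $x\in\mathcal M$; a retraction $R$ on $\mathcal M$ is fixed. Each $f_j\colon\mathcal M\to\mathbb R$ ($j=1,\dots,N$) is smooth and bounded below, and $f=\frac1N\sum_{j=1}^Nf_j$. Retraction smoothness: there is $L_r>0$ such that $f(R_x(v))\le f(x)+\langle\mathrm{grad}f(x),v\rangle_x+\frac{L_r}{2}\|v\|_x^2$ for all $x\in\mathcal M$, $v\in T_x\mathcal M$. Bounded variance estimator: $\Pi$ is a probability distribution on $\{1,\dots,N\}$ with (I) $\mathbb E_{\xi\sim\Pi}[\mathrm{grad}f_\xi(x)]=\mathrm{grad}f(x)$ for all $x\in\mathcal M$, and (II) there is $\sigma>0$ with $\mathbb E_{\xi\sim\Pi}[\|\mathrm{grad}f_\xi(x)-\mathrm{grad}f(x)\|_x^2]\le\sigma^2$ for all $x\in\mathcal M$. RSGD (Riemannian stochastic gradient descent) with learning rates $\eta_t$ and batch sizes $b_t$ (positive integers): from a given deterministic $x_0\in\mathcal M$, $x_{t+1}=R_{x_t}(-\eta_t\,\mathrm{grad}f_{B_t}(x_t))$, where $\mathrm{grad}f_{B_t}(x)=\frac1{b_t}\sum_{i=1}^{b_t}\mathrm{grad}f_{\xi_{i,t}}(x)$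 and $(\xi_{i,t})_{i,t}$ are i.i.d. with law $\Pi$. $\mathbb E$ is the total expectation over all samples. The $O$-notation refers to $T$ (and $b$), with the remaining data fixed. *)

(* Defs.v *)
From HB Require Import structures.
From mathcomp Require Import all_boot all_order all_algebra.
From mathcomp Require Import all_classical all_reals all_analysis.

Set Implicit Arguments.
Unset Strict Implicit.
Unset Printing Implicit Defensive.
Import Order.TTheory GRing.Theory Num.Theory numFieldNormedType.Exports.
Local Open Scope classical_set_scope.
Local Open Scope ring_scope.

(* To be used with [U] open. *)
Fixpoint Ck_on (R : realType) (n : nat) (W : normedModType R) (k : nat)
    (U : set 'rV[R]_n) (f : 'rV[R]_n -> W) : Prop :=
  if k is k'.+1 then
    (forall y, U y -> differentiable f y) /\
    (forall v : 'rV[R]_n, Ck_on k' U (fun y => 'D_v f y))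
  else forall y, U y -> {for y, continuous f}.

Definition smooth_on (R : realType) (n : nat) (W : normedModType R)
    (U : set 'rV[R]_n) (f : 'rV[R]_n -> W) : Prop :=
  forall k, Ck_on k U f.

(* A local homeomorphism from the open set [cdom] of [M] onto the open set
   [ccod] of R^n; [coord] and [param] are total functions whose values
   outside [cdom] and [ccod] are irrelevant. *)
Record chart (R : realType) (n : nat) (M : topologicalType) := Chart {
  cdom : set M;
  ccod : set 'rV[R]_n;
  coord : M -> 'rV[R]_n;
  param : 'rV[R]_n -> M;
  cdom_open : open cdom;
  ccod_open : open ccod;
  coord_ccod : forall x, cdom x -> ccod (coord x);
  param_cdom : forall y, ccod y -> cdom (param y);
  coordK : forall x, cdom x -> param (coord x) = x;
  paramK : forall y, ccod y -> coord (param y) = y;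
  coord_cont : forall x, cdom x -> {for x, continuous coord};
  param_cont : forall y, ccod y -> {for y, continuous param} }.

(* From the components of a tangent vector at [x] in the chart [phi] to its
   components in the chart [psi]. *)
Definition change_coord (R : realType) (n : nat) (M : topologicalType)
    (phi psi : chart R n M) (x : M) (v : 'rV[R]_n) : 'rV[R]_n :=
  'd (coord psi \o param phi) (coord phi x) v.

(* The tangent space at [x] is R^n: a tangent vector is represented by its
   components in the chart [chart_at x] selected at [x]. [metric x] is the
   inner product of T_x M in this representation, and [metric_smooth] says
   that its components in every chart of the atlas are smooth. *)
Record riemannianManifold (R : realType) (n : nat) := RiemannianManifold {
  carrier :> topologicalType;
  carrier_hausdorff : hausdorff_space carrier;
  carrier_second_countable : @second_countable carrier;
  atlas : set (chart R n carrier);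
  chart_at : carrier -> chart R n carrier;
  chart_at_atlas : forall x, atlas (chart_at x);
  chart_at_cdom : forall x, cdom (chart_at x) x;
  atlas_smooth : forall phi psi, atlas phi -> atlas psi ->
    smooth_on (ccod phi `&` param phi @^-1` cdom psi) (coord psi \o param phi);
  metric : carrier -> 'rV[R]_n -> 'rV[R]_n -> R;
  metric_sym : forall x u v, metric x u v = metric x v u;
  metric_linear : forall x (a : R) u v w,
    metric x u (a *: v + w) = a * metric x u v + metric x u w;
  metric_pos : forall x v, v != 0 -> 0 < metric x v v;
  metric_smooth : forall phi, atlas phi -> forall v w : 'rV[R]_n,
    smooth_on (ccod phi) (fun y => let x := param phi y in
      metric x (change_coord phi (chart_at x) x v)
               (change_coord phi (chart_at x) x w)) }.

Definition tangent (R : realType) (n : nat) (M : riemannianManifold R n)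
  (x : M) := 'rV[R]_n.

Section Riemannian.
Context {R : realType} {n : nat} {M : riemannianManifold R n}.

Definition inner (x : M) (u v : tangent x) : R := metric x u v.
Arguments inner x u v : clear implicits.

Definition tnorm (x : M) (v : tangent x) : R := Num.sqrt (inner x v v).
Arguments tnorm x v : clear implicits.

Definition smooth_fun (f : M -> R) : Prop :=
  forall phi, atlas phi -> smooth_on (ccod phi) (f \o param phi).

Definition dfun (f : M -> R) (x : M) (v : tangent x) : R :=
  'd (f \o param (chart_at x)) (coord (chart_at x) x) v.
Arguments dfun f x v : clear implicits.

Definition grad (f : M -> R) (x : M) : tangent x :=
  get [set g : tangent x | forall v : tangent x, inner x g v = dfun f x v].

(* The continuity of [Rt x] at 0 makes the expression of [Rt x] in the chart
   at [x] meaningful around 0. *)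
Definition retraction (Rt : forall x : M, tangent x -> M) : Prop :=
  forall x : M,
    [/\ Rt x 0 = x,
        {for (0 : tangent x), continuous (Rt x)} &
        is_diff (0 : tangent x) (coord (chart_at x) \o Rt x) id].

Definition retraction_smooth (Rt : forall x : M, tangent x -> M)
    (f : M -> R) (Lr : R) : Prop :=
  forall (x : M) (v : tangent x),
    f (Rt x v) <= f x + inner x (grad f x) v + Lr / 2 * tnorm x v ^+ 2.

Definition bounded_below (f : M -> R) : Prop :=
  exists c : R, forall x, c <= f x.

Definition average (N : nat) (fs : 'I_N -> M -> R) (x : M) : R :=
  N%:R^-1 * \sum_(j < N) fs j x.

Definition pmf (N : nat) (Pi : 'I_N -> R) : Prop :=
  (forall j, 0 <= Pi j) /\ \sum_(j < N) Pi j = 1.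

Definition bounded_variance (N : nat) (fs : 'I_N -> M -> R)
    (Pi : 'I_N -> R) (sigma : R) : Prop :=
  [/\ pmf Pi,
      forall x : M,
        \sum_(j < N) Pi j *: grad (fs j) x = grad (average fs) x &
      forall x : M,
        \sum_(j < N) Pi j * tnorm x (grad (fs j) x - grad (average fs) x) ^+ 2
          <= sigma ^+ 2].

(* [xi (i, t)] is the sample of index [i] in the batch of iteration [t], with
   batches indexed from 0; the learning rate [eta] and the batch size [b] are
   those of a single run. *)
Fixpoint rsgd (Rt : forall x : M, tangent x -> M) (N : nat)
    (fs : 'I_N -> M -> R) (eta : nat -> R) (b : nat -> nat) (Omega : Type)
    (xi : nat * nat -> Omega -> 'I_N) (x0 : M) (t : nat) (w : Omega) : M :=
  if t is t'.+1 then
    let x := rsgd Rt fs eta b xi x0 t' w in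
    Rt x (- (eta t' *:
      ((b t')%:R^-1 *: \sum_(i < b t') grad (fs (xi (val i, t') w)) x)))
  else x0.

End Riemannian.

Arguments inner {R n M} x u v.
Arguments tnorm {R n M} x v.
Arguments dfun {R n M} f x v.

(* 'I_N carries the discrete sigma-algebra, so that all of its subsets are
   tested. *)
Definition iid_samples (d : measure_display) (Omega : measurableType d)
    (R : realType) (P : probability Omega R) (N : nat) (Pi : 'I_N -> R)
    (K : choiceType) (xi : K -> Omega -> 'I_N) : Prop :=
  [/\ forall k (A : set 'I_N), measurable (xi k @^-1` A),
      forall k j, P (xi k @^-1` [set j]) = (Pi j)%:E &
      forall (s : seq K) (A : K -> set 'I_N), uniq s ->
        P (\bigcap_(k in [set` s]) (xi k @^-1` A k)) =
        (\prod_(k <- s) P (xi k @^-1` A k))%E].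

(* A learning rate gives eta_t from the number T of iterations and t. *)
Section LearningRates.
Context {R : realType} (eta_min eta_max p : R).

Definition lr_constant (T t : nat) : R := eta_max.

Definition lr_diminishing (T t : nat) : R := eta_max / Num.sqrt (t.+1)%:R.

Definition lr_cosine (T t : nat) : R :=
  eta_min + (eta_max - eta_min) / 2 * (1 + cos (t%:R / T%:R * pi)).

Definition lr_polynomial (T t : nat) : R :=
  eta_min + (eta_max - eta_min) * (1 - t%:R / T%:R) `^ p.

End LearningRates.

Definition min_sq_grad (R : realType) (n : nat) (M : riemannianManifold R n)
    (f : M -> R) (d : measure_display) (Omega : measurableType d)
    (P : probability Omega R) (x : nat -> Omega -> M) (T : nat) : \bar R :=
  \big[Order.min/+oo%E]_(t < T) 'E_P[fun w => (tnorm (x t w) (grad f (x t w)) ^+ 2)%R]%E.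

(* Main.v *)
Require Import Defs.
From mathcomp Require Import all_boot all_order all_algebra.
From mathcomp Require Import all_classical all_reals all_analysis.
From mathcomp Require Import measurable_realfun ring lra zify.
Import Order.TTheory GRing.Theory Num.Theory numFieldNormedType.Exports.
Local Open Scope classical_set_scope.
Local Open Scope ring_scope.

(** The state x_t is a function of the samples drawn before time t, hence
    independent of the batch of time t; so E[g(x_t)] is computed by t
    successive finite averages over one batch, a deterministic operator in
    which monotonicity and linearity are elementary.  One such average turns
    retraction smoothness into
      E f(x_{t+1}) <= E f(x_t) - eta_t (1 - Lr eta_t / 2) E|grad f(x_t)|^2
                      + Lr sigma^2 eta_t^2 / (2 b),
    the variance of a mini-batch being at most sigma^2 / b because the cross
    terms vanish.  Telescoping bounds the minimum by
      (f(x_0) - inf f + Lr sigma^2 / (2 b) * sum eta_t^2)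
        / ((1 - Lr eta_max / 2) * sum eta_t).
    For (2), sum eta_t >= eta_max sqrt T and sum eta_t^2 <= eta_max^2 (1 + ln T).
    For (1), (3), (4), eta_t is at least a fixed multiple of eta_max as long as
    2 t <= T, so sum eta_t grows linearly, and sum eta_t^2 <= eta_max sum eta_t. *)

(** * Moments of a batch under the product law *)

Definition batch_weight {R : realType} {N : nat} (Pi : 'I_N -> R) {b : nat}
  (beta : {ffun 'I_b -> 'I_N}) : R := \prod_i Pi (beta i).

Lemma batch_weight_ge0 (R : realType) (N : nat) (Pi : 'I_N -> R) (b : nat)
    (beta : {ffun 'I_b -> 'I_N}) : Defs.pmf Pi -> 0 <= batch_weight Pi beta.
Proof. by move=> [Pi0 _]; apply: prodr_ge0. Qed.

(** A product of sums expands over all choice functions: Fubini for the product law. Moments are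
    read off by setting the factors of the other samples to 1. *)
Lemma sum_batch_weight_prod (R : realType) (N : nat) (Pi : 'I_N -> R) (b : nat)
    (u : 'I_b -> 'I_N -> R) :
  \sum_(beta : {ffun 'I_b -> 'I_N}) batch_weight Pi beta * \prod_i u i (beta i)
    = \prod_i \sum_j Pi j * u i j.
Proof.
by rewrite bigA_distr_bigA; apply: eq_bigr => beta _; rewrite -big_split.
Qed.

Section BatchMoments.
Context {R : realType} {N : nat} {Pi : 'I_N -> R} {b : nat} (HPi : Defs.pmf Pi).
Implicit Types (beta : {ffun 'I_b -> 'I_N}).

Lemma sum_batch_weight : \sum_beta batch_weight (b := b) Pi beta = 1.
Proof.
rewrite -(bigA_distr_bigA (fun=> Pi)) big1// => i _.
exact: (proj2 HPi).
Qed.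

Lemma batch_mean (k : 'I_b) (u : 'I_N -> R) :
  \sum_beta batch_weight (b := b) Pi beta * u (beta k) = \sum_j Pi j * u j.
Proof.
transitivity (\prod_i \sum_j Pi j * (if i == k then u j else 1)).
  rewrite -sum_batch_weight_prod; apply: eq_bigr => beta _; congr (_ * _).
  by rewrite -big_mkcond big_pred1_eq.
rewrite (bigD1 k)//= [X in _ * X]big1 ?mulr1 => [|i /negPf ik].
  by apply: eq_bigr => j _; rewrite eqxx.
rewrite -[RHS](proj2 HPi); apply: eq_bigr => j _; by rewrite ik mulr1.
Qed.

(** Independence of two coordinates of the product law: the factors other than those of [k] and [l]
    sum to 1. *)
Lemma batch_mean2 (k l : 'I_b) (u v : 'I_N -> R) : k != l ->
  \sum_beta batch_weight (b := b) Pi beta * (u (beta k) * v (beta l)) =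
    (\sum_j Pi j * u j) * (\sum_j Pi j * v j).
Proof.
move=> kl.
transitivity (\prod_i \sum_j Pi j *
    ((if i == k then u j else 1) * (if i == l then v j else 1))).
  rewrite -sum_batch_weight_prod; apply: eq_bigr => beta _; congr (_ * _).
  by rewrite big_split/= -!big_mkcond !big_pred1_eq.
rewrite (bigD1 k)//= (bigD1 l) 1?eq_sym//=.
rewrite [X in _ * (_ * X)]big1 ?mulr1 => [|i /andP[]].
  congr (_ * _); apply: eq_bigr => j _; rewrite eqxx.
    by rewrite [l == k]eq_sym (negPf kl) mulr1.
  by rewrite [l == k]eq_sym (negPf kl) mul1r.
move=> /negPf ik /negPf il.
by rewrite -[RHS](proj2 HPi); apply: eq_bigr => j _; rewrite ik il !mulr1.
Qed.

End BatchMoments.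

(** * Algebra of the inner product on one tangent space *)

Section InnerProduct.
Context {R : realType} {n : nat} {M : riemannianManifold R n} (x : M).
Implicit Types (u v w : tangent x).

Lemma innerC u v : inner x u v = inner x v u.
Proof. by rewrite /inner Defs.metric_sym. Qed.

Lemma innerDr u v w : inner x u (v + w) = inner x u v + inner x u w.
Proof. by rewrite -[v in LHS]scale1r /inner Defs.metric_linear mul1r. Qed.

Lemma inner0r u : inner x u 0 = 0.
Proof. by apply/(addIr (inner x u 0)); rewrite -innerDr !add0r. Qed.

Lemma innerZr a u v : inner x u (a *: v) = a * inner x u v.
Proof.
rewrite -[a *: v]addr0 /inner Defs.metric_linear.
by rewrite -[metric x u 0]/(inner x u 0) inner0r addr0.
Qed.

Lemma inner_sumr (I : Type) (r : seq I) (P : pred I) u (F : I -> tangent x) :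
  inner x u (\sum_(i <- r | P i) F i) = \sum_(i <- r | P i) inner x u (F i).
Proof. exact: (big_morph _ (innerDr u) (inner0r u)). Qed.

Lemma inner_ge0 u : 0 <= inner x u u.
Proof.
have [->|u0] := eqVneq (u : 'rV[R]_n) 0; first by rewrite inner0r.
exact/ltW/Defs.metric_pos.
Qed.

Lemma sqr_tnorm u : tnorm x u ^+ 2 = inner x u u.
Proof. by rewrite sqr_sqrtr// inner_ge0. Qed.

Lemma sqr_tnormZ a u : tnorm x (a *: u) ^+ 2 = a ^+ 2 * tnorm x u ^+ 2.
Proof. by rewrite !sqr_tnorm innerZr innerC innerZr mulrA. Qed.

Lemma sqr_tnormD u v :
  tnorm x (u + v) ^+ 2 = tnorm x u ^+ 2 + 2 * inner x u v + tnorm x v ^+ 2.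
Proof.
rewrite !sqr_tnorm innerDr !(innerC (u + v)) !innerDr (innerC v u); ring.
Qed.

End InnerProduct.

(** * Mean and variance of centred mini-batch noise *)

Section MiniBatch.
Context {R : realType} {n : nat} {M : riemannianManifold R n} {x : M}.
Context {N : nat} {Pi : 'I_N -> R} {b : nat} (HPi : Defs.pmf Pi).
Context {D : 'I_N -> tangent x} (meanD : \sum_j Pi j *: D j = 0).

(** Removes the term of the descent inequality that is linear in the noise. *)
Lemma batch_mean_inner (u : tangent x) :
  \sum_(beta : {ffun 'I_b -> 'I_N}) batch_weight Pi beta *
    inner x u (b%:R^-1 *: \sum_i D (beta i)) = 0.
Proof.
under eq_bigr => beta _ do
  rewrite innerZr inner_sumr mulrCA mulr_sumr.
rewrite -mulr_sumr exchange_big big1 ?mulr0// => i _ /=.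
rewrite (batch_mean HPi i (fun j => inner x u (D j))).
under eq_bigr do rewrite -innerZr.
by rewrite -inner_sumr meanD inner0r.
Qed.

Lemma batch_mean_cross (k l : 'I_b) : k != l ->
  \sum_(beta : {ffun 'I_b -> 'I_N}) batch_weight Pi beta *
    inner x (D (beta k)) (D (beta l)) = 0.
Proof.
move=> kl.
(* The inner product is split into products of functions of one sample by
   means of indicators of the values of the k-th sample. *)
have E beta : inner x (D (beta k)) (D (beta l)) =
    \sum_j (beta k == j)%:R * inner x (D j) (D (beta l)) :> R.
  rewrite (bigD1 (beta k))//= eqxx mul1r big1 ?addr0// => j.
  by rewrite eq_sym => /negPf ->; rewrite mul0r.
under eq_bigr => beta _ do rewrite E mulr_sumr.
rewrite exchange_big big1// => j _ /=.
rewrite (batch_mean2 HPi k l (fun i => (i == j)%:R)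
  (fun i => inner x (D j) (D i)) kl).
under [X in _ * X]eq_bigr do rewrite -innerZr.
by rewrite -inner_sumr meanD inner0r mulr0.
Qed.

(** Of the [b ^ 2] terms of the expanded square only the [b] diagonal ones survive; against the
    prefactor [b ^ -2] this leaves [1 / b]. *)
Lemma batch_variance (s : R) : (0 < b)%N ->
  \sum_j Pi j * tnorm x (D j) ^+ 2 <= s ->
  \sum_(beta : {ffun 'I_b -> 'I_N}) batch_weight Pi beta *
    tnorm x (b%:R^-1 *: \sum_i D (beta i)) ^+ 2 <= s / b%:R.
Proof.
move=> b0 Ds.
have b0' : b%:R != 0 :> R by rewrite pnatr_eq0 -lt0n.
under eq_bigr => beta _.
  rewrite sqr_tnormZ sqr_tnorm inner_sumr mulrCA mulr_sumr.
  under eq_bigr => i _ do rewrite innerC inner_sumr mulr_sumr.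
  over.
rewrite -mulr_sumr exchange_big /=.
have -> : \sum_(i < b) \sum_(beta : {ffun 'I_b -> 'I_N}) \sum_(k < b)
    batch_weight Pi beta * inner x (D (beta i)) (D (beta k)) =
    \sum_(i < b) \sum_j Pi j * tnorm x (D j) ^+ 2.
  apply: eq_bigr => i _.
  rewrite exchange_big (bigD1 i)//= [X in _ + X]big1 ?addr0.
    rewrite (batch_mean HPi i (fun j => inner x (D j) (D j))).
    by apply: eq_bigr => j _; rewrite sqr_tnorm.
  by move=> k ki; rewrite batch_mean_cross// eq_sym.
rewrite sumr_const card_ord; set v := \sum_j _ in Ds *.
rewrite -[v *+ b]mulr_natr.
have -> : b%:R^-1 ^+ 2 * (v * b%:R) = v / b%:R by field.
by rewrite ler_pM2r// invr_gt0 ltr0n.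
Qed.

End MiniBatch.

(** * Expectations along the chain as iterated finite averages *)

Section Chain.
Context {R : realType} {N b : nat} {X : Type}.
Context (Pi : 'I_N -> R) (step : nat -> {ffun 'I_b -> 'I_N} -> X -> X).

(** Composition of the transition operators, that of the latest step acting on [g] first. The
    recursion changes [g], so inductions on [t] keep [g] general. *)
Fixpoint chain_mean (t : nat) (g : X -> R) : X -> R :=
  if t is t'.+1 then
    chain_mean t' (fun x =>
      \sum_(beta : {ffun 'I_b -> 'I_N})
        batch_weight Pi beta * g (step t' beta x))
  else g.

Lemma chain_mean_sum (I : finType) (c : I -> R) (h : I -> X -> R) t x :
  chain_mean t (fun y => \sum_i c i * h i y) x =
  \sum_i c i * chain_mean t (h i) x.
Proof.
elim: t h => [//|t IHt] h /=; rewrite -IHt; congr (chain_mean t _ x).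
apply: funext => y; under eq_bigr do rewrite mulr_sumr.
rewrite exchange_big; apply: eq_bigr => i _; rewrite mulr_sumr.
by apply: eq_bigr => beta _; rewrite mulrCA.
Qed.

Context (HPi : Defs.pmf Pi).

(** The shape is that of the right-hand side of the one-step descent. The constant survives because
    the batch weights sum to 1. *)
Lemma chain_mean_affine (a c : R) (g h : X -> R) t x :
  chain_mean t (fun y => g y + a * h y + c) x =
  chain_mean t g x + a * chain_mean t h x + c.
Proof.
elim: t g h => [//|t IHt] g h /=; rewrite -IHt; congr (chain_mean t _ x).
apply: funext => y.
rewrite -[in RHS](mul1r c) -(sum_batch_weight (b := b) HPi).
rewrite mulr_sumr mulr_suml -!big_split/=.
by apply: eq_bigr => beta _; ring.
Qed.

Lemma chain_mean_le (g h : X -> R) t x :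
  (forall y, g y <= h y) -> chain_mean t g x <= chain_mean t h x.
Proof.
elim: t g h => [|t IHt] g h gh /=; first exact: gh.
by apply: IHt => y; apply: ler_sum => beta _;
  rewrite ler_wpM2l// batch_weight_ge0.
Qed.

Context (d : measure_display) (Omega : measurableType d)
  (P : probability Omega R) (xi : nat * nat -> Omega -> 'I_N)
  (x0 : X) (x : nat -> Omega -> X).
Context (iid : iid_samples P Pi xi).

Definition batch t w : {ffun 'I_b -> 'I_N} := [ffun i => xi (val i, t) w].

Context (x_0 : forall w, x 0%N w = x0).
Context (x_S : forall t w, x t.+1 w = step t (batch t w) (x t w)).

(** Cylinder event, in the form in which independence of the samples is stated. *)
Definition sample_event (s : seq (nat * nat)) (A : nat * nat -> set 'I_N) :=
  \bigcap_(k in [set` s]) (xi k @^-1` A k).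

Lemma measurable_sample_event s A : measurable (sample_event s A).
Proof.
rewrite /sample_event bigcap_seq; apply: bigsetI_measurable => k _.
by case: iid.
Qed.

Definition batch_keys (t : nat) : seq (nat * nat) :=
  [seq (val i, t) | i <- enum 'I_b].

Lemma batch_keys_uniq t : uniq (batch_keys t).
Proof. by rewrite map_inj_uniq ?enum_uniq// => i j [/val_inj]. Qed.

Lemma mem_batch_keys t (i : 'I_b) : (val i, t) \in batch_keys t.
Proof. by apply/mapP; exists i => //; rewrite mem_enum. Qed.

(* Only the values at keys of time t are changed: at the key (i, t) the sample
   is forced to be beta i, whatever the value of A there. *)
Definition with_batch t (beta : {ffun 'I_b -> 'I_N}) (A : nat * nat -> set 'I_N)
    (k : nat * nat) : set 'I_N :=
  if k.2 == t then [set j | forall i : 'I_b, val i = k.1 -> j = beta i]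
  else A k.

Lemma with_batch_key t beta A (i : 'I_b) :
  with_batch t beta A (val i, t) = [set beta i].
Proof.
rewrite /with_batch eqxx; apply/seteqP; split=> j /=; first exact.
by move=> -> k /val_inj ->.
Qed.

(** The keys of [s] are later than [t], so fixing the batch of time [t] leaves their constraints
    untouched. *)
Lemma sample_event_with_batch t beta A s w :
  (forall k, k \in s -> (t < k.2)%N) ->
  sample_event (batch_keys t ++ s) (with_batch t beta A) w <->
  sample_event s A w /\ batch t w = beta.
Proof.
move=> ts; have sA k : k \in s -> with_batch t beta A k = A k.
  by move=> /ts; rewrite /with_batch; case: eqP => // ->; rewrite ltnn.
split=> [H|[sw <-] k /=].
  split.
    by move=> k /= ks; rewrite -(sA k ks); apply: H; rewrite /= mem_cat ks orbT.
  apply/ffunP => i; rewrite ffunE.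
  have := H (val i, t); rewrite /= with_batch_key; apply.
  by rewrite mem_cat mem_batch_keys.
rewrite mem_cat => /orP[/mapP[i _ ->]|ks].
  by rewrite /= with_batch_key /= ffunE.
by have := sw k ks; rewrite /= -(sA k ks) /with_batch; case: ifP => // /eqP kt;
  have := ts k ks; rewrite kt ltnn.
Qed.

(** The concatenated keys are distinct, so independence factors the probability; the keys of time
    [t] contribute the product of the [Pi (beta i)]. *)
Lemma prob_with_batch t beta A s : uniq s ->
  (forall k, k \in s -> (t < k.2)%N) ->
  P (sample_event (batch_keys t ++ s) (with_batch t beta A)) =
  ((batch_weight Pi beta)%:E * P (sample_event s A))%E.
Proof.
move=> us ts; have [_ law indep] := iid.
rewrite /sample_event !indep//; last first.
  rewrite cat_uniq batch_keys_uniq us andbT /=; apply/hasPn => k /ts tk.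
  by apply/mapP => -[i _ ki]; rewrite ki ltnn in tk.
rewrite big_cat/=; congr (_ * _)%E.
  rewrite big_map big_enum /= /batch_weight -prodEFin.
  by apply: eq_bigr => i _; rewrite with_batch_key law.
rewrite big_seq [RHS]big_seq; apply: eq_bigr => k ks.
by have := ts k ks; rewrite /with_batch; case: eqP => // ->; rewrite ltnn.
Qed.

Lemma sample_event_partition t s A : (forall k, k \in s -> (t < k.2)%N) ->
  sample_event s A = \big[setU/set0]_(beta <- enum {ffun 'I_b -> 'I_N})
    sample_event (batch_keys t ++ s) (with_batch t beta A).
Proof.
move=> ts; rewrite -bigcup_seq; apply/seteqP; split=> w.
  move=> sw; exists (batch t w); first by rewrite /= mem_enum.
  exact/sample_event_with_batch.
by move=> [beta _] /sample_event_with_batch[].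
Qed.

(** [X] carries no sigma-algebra: [x t] is determined by finitely many samples with finitely many
    values, so every subset has a measurable preimage. *)
Lemma measurable_chain t (B : set X) : measurable (x t @^-1` B).
Proof.
elim: t B => [|t IHt] B.
  rewrite (_ : _ @^-1` _ = [set _ | B x0]); last first.
    by apply/seteqP; split=> w /=; rewrite x_0.
  have [Bx|Bx] := pselect (B x0).
    by rewrite (_ : mkset _ = setT)//; apply/seteqP; split.
  by rewrite (_ : mkset _ = set0)//; apply/seteqP; split.
(* Split on the value of the last batch. With no further keys, each event only says that the batch
   of time [t] is [beta]. *)
rewrite (_ : _ @^-1` _ = \big[setU/set0]_(beta <- enum {ffun 'I_b -> 'I_N})
    (sample_event (batch_keys t ++ [::]) (with_batch t beta (fun=> setT)) `&`
      x t @^-1` (step t beta @^-1` B))); last first.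
  rewrite -bigcup_seq; apply/seteqP; split=> w /=.
    rewrite x_S => Bw; exists (batch t w); first by rewrite /= mem_enum.
    by split => //; apply/sample_event_with_batch.
  by move=> [beta _ [/sample_event_with_batch[]// _ <-]]; rewrite /= x_S.
apply: bigsetU_measurable => beta _.
by apply: measurableI => //; exact: measurable_sample_event.
Qed.

Lemma measurable_fun_chain t (g : X -> R) (D : set Omega) :
  measurable_fun D (fun w => g (x t w)).
Proof.
apply: (@measurable_funS _ _ _ _ setT) => // _ Y _; rewrite setTI.
exact: (measurable_chain t (g @^-1` Y)).
Qed.

(* Samples that are not used before time t are independent of x t. *)
Lemma integral_chain t (g : X -> R) s A : uniq s ->
  (forall k, k \in s -> (t <= k.2)%N) ->
  (\int[P]_(w in sample_event s A) (g (x t w))%:E =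
    (chain_mean t g x0)%:E * P (sample_event s A))%E.
Proof.
elim: t g s A => [|t IHt] g s A us ts.
  rewrite -integral_cst; last exact: measurable_sample_event.
  by apply: eq_integral => w _; rewrite x_0.
(* On the piece where the batch of time [t] is [beta], [x t.+1] is [step t beta (x t)]. The
   induction hypothesis then applies to the longer key list, all of whose times are at least [t]. *)
rewrite [in LHS](sample_event_partition t s A ts) integral_bigsetU_EFin/=;
  first last.
- by apply/measurable_EFinP; exact: measurable_fun_chain.
- move=> beta gamma _ _ [w [/sample_event_with_batch[]// _ <-]].
  by move=> /sample_event_with_batch[].
- exact: enum_uniq.
- by move=> beta; exact: measurable_sample_event.
rewrite big_enum/= chain_mean_sum.
have /fineK <- : P (sample_event s A) \is a fin_num.
  exact/fin_num_measure/measurable_sample_event.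
rewrite -EFinM mulr_suml -sumEFin; apply: eq_big => // beta _.
transitivity (\int[P]_(w in sample_event (batch_keys t ++ s)
    (with_batch t beta A)) (g (step t beta (x t w)))%:E)%E.
  apply: eq_integral => w /set_mem /sample_event_with_batch[]// _ <-.
  by rewrite x_S.
rewrite (IHt (g \o step t beta)).
- rewrite prob_with_batch// -{1}[P (sample_event s A)]fineK.
    by rewrite -!EFinM mulrCA mulrA.
  exact/fin_num_measure/measurable_sample_event.
- rewrite cat_uniq batch_keys_uniq us andbT /=; apply/hasPn => k /ts tk.
  by apply/mapP => -[i _ ki]; rewrite ki ltnn in tk.
- by move=> k; rewrite mem_cat => /orP[/mapP[i _ ->]//|/ts /ltnW].
Qed.

(** With no constrained key the event is the whole space, of probability 1. *)
Lemma expectation_chain t (g : X -> R) :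
  ('E_P[fun w => g (x t w)] = (chain_mean t g x0)%:E)%E.
Proof.
have := @integral_chain t g [::] (fun=> setT) isT.
have -> : sample_event [::] (fun=> setT) = setT.
  by apply/seteqP; split.
by rewrite probability_setT mule1 unlock; apply.
Qed.

End Chain.

(** * One-step descent, telescoping, and the bound on the minimum *)

Section Descent.
Context {R : realType} {n : nat} {M : riemannianManifold R n}.
Context {Rt : forall x : M, tangent x -> M} {N : nat} {fs : 'I_N -> M -> R}.
Context {Pi : 'I_N -> R} {Lr sigma : R}.
Context (Lr_gt0 : 0 < Lr) (smooth : retraction_smooth Rt (average fs) Lr).
Context (variance : bounded_variance fs Pi sigma).
Context {b : nat} (b_gt0 : (0 < b)%N).

Definition sgd_step (eta : R) (beta : {ffun 'I_b -> 'I_N}) (x : M) : M :=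
  Rt x (- (eta *: (b%:R^-1 *: \sum_i grad (fs (beta i)) x))).

Definition sq_grad (x : M) : R := tnorm x (grad (average fs) x) ^+ 2.

Lemma mean_sgd_descent (eta : R) (x : M) :
  \sum_(beta : {ffun 'I_b -> 'I_N})
    batch_weight Pi beta * average fs (sgd_step eta beta x) <=
  average fs x + (- (eta * (1 - Lr / 2 * eta))) * sq_grad x
    + Lr / 2 * (sigma ^+ 2 / b%:R) * eta ^+ 2.
Proof.
have [HPi unbiased var] := variance.
rewrite /sq_grad; move: (unbiased x) (var x) (smooth x).
move: (grad (average fs) x) => g unb varx smoothx.
pose D j : tangent x := grad (fs j) x - g.
have meanD : \sum_j Pi j *: D j = 0.
  under eq_bigr do rewrite scalerBr.
  by rewrite sumrB unb -scaler_suml (proj2 HPi) scale1r subrr.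
(* The batch gradient is [g] plus the centred noise [Db]. *)
pose Db (beta : {ffun 'I_b -> 'I_N}) : tangent x :=
  b%:R^-1 *: \sum_i D (beta i).
have b0 : b%:R != 0 :> R by rewrite pnatr_eq0 -lt0n.
have gradE (beta : {ffun 'I_b -> 'I_N}) :
    b%:R^-1 *: \sum_i grad (fs (beta i)) x = g + Db beta.
  rewrite /Db sumrB sumr_const card_ord scalerBr -[g *+ b]scaler_nat.
  by rewrite scalerA mulVf// scale1r addrC subrK.
(* Retraction smoothness at [- eta (g + Db)], expanded and sorted into a constant, a part linear in
   [Db] and a part quadratic in [Db]. *)
apply: (@le_trans _ _ (\sum_(beta : {ffun 'I_b -> 'I_N})
    ((average fs x - eta * (1 - Lr / 2 * eta) * tnorm x g ^+ 2)
       * batch_weight Pi beta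
     + (Lr * eta ^+ 2 - eta) * (batch_weight Pi beta * inner x g (Db beta))
     + Lr / 2 * eta ^+ 2 * (batch_weight Pi beta * tnorm x (Db beta) ^+ 2)))).
  apply: ler_sum => beta _.
  apply: (le_trans (ler_wpM2l (batch_weight_ge0 _ _ _ _ _ HPi)
    (smoothx _))).
  rewrite gradE -scaleNr sqr_tnormZ sqr_tnormD innerZr innerDr.
  rewrite -sqr_tnorm le_eqVlt; apply/orP; left; apply/eqP.
  by field.
rewrite !big_split/= -!mulr_sumr sum_batch_weight// mulr1.
rewrite (batch_mean_inner HPi meanD) mulr0 addr0 mulNr lerD2l.
rewrite [leRHS](_ : _ = Lr / 2 * eta ^+ 2 * (sigma ^+ 2 / b%:R)); last by ring.
rewrite ler_wpM2l//.
  by rewrite mulr_ge0 ?sqr_ge0// divr_ge0// ltW.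
exact: (batch_variance HPi meanD).
Qed.

Context {x0 : M} {d : measure_display} {Omega : measurableType d}.
Context {P : probability Omega R} {xi : nat * nat -> Omega -> 'I_N}.
Context (iid : iid_samples P Pi xi).
Context {lb : R} (f_ge : forall x, lb <= average fs x).

Lemma expectation_rsgd (eta : nat -> R) (h : M -> R) t :
  ('E_P[fun w => h (rsgd Rt fs eta (fun=> b) xi x0 t w)] =
  (chain_mean Pi (fun t => sgd_step (eta t)) t h x0)%:E)%E.
Proof.
pose X := rsgd Rt fs eta (fun=> b) xi x0.
have X_S s w : X s.+1 w = sgd_step (eta s) (batch d Omega xi s w) (X s w).
  suff stepE y : Rt y (- (eta s *: (b%:R^-1 *:
      \sum_(i < b) grad (fs (xi (val i, s) w)) y))) =
      sgd_step (eta s) (batch d Omega xi s w) y by exact: (stepE (X s w)).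
  have batchE : \sum_(i < b)
      grad (fs ((batch d Omega xi s w : {ffun 'I_b -> 'I_N}) i)) y =
      \sum_(i < b) grad (fs (xi (val i, s) w)) y.
    by apply: eq_bigr => i _; rewrite ffunE.
  exact: (congr1 (fun v => Rt y (- (eta s *: (b%:R^-1 *: v)))) (esym batchE)).
exact: (@expectation_chain R N b M Pi (fun t => sgd_step (eta t))
  d Omega P xi x0 X iid (fun=> erefl) X_S).
Qed.

Lemma sum_sq_grad_le (eta : nat -> R) T :
  \sum_(t < T) eta t * (1 - Lr / 2 * eta t) *
     chain_mean Pi (fun t => sgd_step (eta t)) t sq_grad x0 <=
  average fs x0 - lb +
    Lr / 2 * (sigma ^+ 2 / b%:R) * \sum_(t < T) eta t ^+ 2.
Proof.
have [HPi _ _] := variance.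
pose V t h := chain_mean Pi (fun t => sgd_step (eta t)) t h x0.
have VT : lb <= V T (average fs).
  have <- : V T (fun=> lb) = lb.
    (* Writing the constant as [h - h + lb] makes it an affine combination, which the averages
       preserve. *)
    transitivity (V T sq_grad + (-1) * V T sq_grad + lb); last by ring.
    rewrite -(chain_mean_affine _ _ HPi); congr (chain_mean _ _ T _ x0).
    by apply: funext => y; ring.
  exact: chain_mean_le.
(* The induction has to keep the current mean value of the objective on the left; [lb] replaces it
   only at the end. *)
suff H : V T (average fs) + \sum_(t < T) eta t * (1 - Lr / 2 * eta t) *
    V t sq_grad <= average fs x0 +
    Lr / 2 * (sigma ^+ 2 / b%:R) * \sum_(t < T) eta t ^+ 2.
  by rewrite -/V; lra.
elim: T {VT} => [|T IHT]; first by rewrite !big_ord0 mulr0 !addr0.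
rewrite !big_ord_recr/= mulrDr.
have : V T.+1 (average fs) <= V T (average fs) +
    (- (eta T * (1 - Lr / 2 * eta T))) * V T sq_grad +
    Lr / 2 * (sigma ^+ 2 / b%:R) * eta T ^+ 2.
  rewrite -(chain_mean_affine _ _ HPi) .
  apply: (chain_mean_le Pi _ HPi (fun x =>
    \sum_(beta : {ffun 'I_b -> 'I_N})
      batch_weight Pi beta * average fs (sgd_step (eta T) beta x))) => y.
  exact: mean_sgd_descent.
rewrite mulNr; lra.
Qed.

(** A minimum is at most the mean weighted by [eta t]; [eta t <= eta_max] gives one common lower
    bound for the factors [1 - Lr / 2 * eta t]. *)
Lemma min_sq_grad_rsgd (eta : nat -> R) (eta_max : R) T :
  (forall t, (t < T)%N -> 0 <= eta t <= eta_max) -> eta_max < 2 / Lr ->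
  0 < \sum_(t < T) eta t ->
  (min_sq_grad (average fs) P (rsgd Rt fs eta (fun=> b) xi x0) T <=
   ((average fs x0 - lb +
      Lr / 2 * (sigma ^+ 2 / b%:R) * \sum_(t < T) eta t ^+ 2) /
    ((1 - Lr / 2 * eta_max) * \sum_(t < T) eta t))%:E)%E.
Proof.
move=> eta_itv eta_lt S_gt0.
have kappa_gt0 : 0 < 1 - Lr / 2 * eta_max.
  by move: eta_lt; rewrite ltr_pdivlMr// => eta_lt; lra.
(* For [T = 0] the minimum would be [+oo]; the positive sum excludes this. *)
case: T eta_itv S_gt0 => [|T] eta_itv S_gt0.
  by rewrite big_ord0 ltxx in S_gt0.
have := sum_sq_grad_le eta T.+1.
pose V t := chain_mean Pi (fun t => sgd_step (eta t)) t sq_grad x0.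
rewrite -/(V _) => V_sum.
have sq_grad_ge0 y : 0 <= sq_grad y by exact: sqr_ge0.
case: (arg_minP (fun t : 'I_T.+1 => V t) (i0 := ord0) (P := xpredT))
  => // i _ iP.
apply: (@le_trans _ _ (V i)%:E).
  by rewrite -expectation_rsgd; apply: bigmin_le.
rewrite lee_fin ler_pdivlMr ?mulr_gt0//; apply: le_trans V_sum.
rewrite mulrA mulr_sumr; apply: ler_sum => t _.
have /andP[eta0 eta1] := eta_itv t (ltn_ord t).
have V0 : 0 <= V i.
  have [HPi _ _] := variance.
  have -> : 0 = V i + (-1) * V i + 0 by ring.
  rewrite -(chain_mean_affine _ _ HPi); apply: chain_mean_le => // y.
  by rewrite mulN1r subrr addr0.
have kappa_le : 1 - Lr / 2 * eta_max <= 1 - Lr / 2 * eta t.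
  by rewrite lerD2l lerN2 ler_wpM2l// divr_ge0// ltW.
rewrite [leLHS](_ : _ = eta t * ((1 - Lr / 2 * eta_max) * V i)); last by ring.
rewrite -[leRHS]mulrA ler_wpM2l// ler_pM//; first exact: ltW.
exact: iP.
Qed.

End Descent.

(** * Sums and bounds of the learning rates *)

(* Pair t with T - 1 - t: one of the two indices is in the first half. *)
Lemma sum_ge_half {R : realType} (T : nat) (eta : nat -> R) (a : R) :
  (forall t, (t < T)%N -> 0 <= eta t) ->
  (forall t, (t < T)%N -> (t.*2 <= T)%N -> a <= eta t) ->
  a / 2 * T%:R <= \sum_(t < T) eta t.
Proof.
move=> eta_ge0 eta_ge.
have : \sum_(t < T) a <= \sum_(t < T) (eta t + eta (rev_ord t)).
  apply: ler_sum => t _.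
  have t0 := eta_ge0 _ (ltn_ord t); have r0 := eta_ge0 _ (ltn_ord (rev_ord t)).
  have [tT|tT] := leqP t.*2 T.
    by rewrite -[leLHS]addr0 lerD// eta_ge.
  rewrite -[leLHS]add0r lerD// eta_ge ?ltn_ord//=.
  by move: tT (ltn_ord t); lia.
have rev_sum : \sum_(t < T) eta (rev_ord t) = \sum_(t < T) eta t.
  by rewrite [RHS](reindex_inj rev_ord_inj).
rewrite big_split/= rev_sum.
rewrite sumr_const card_ord -mulr_natr; lra.
Qed.

(** The rate is a convex combination of [eta_min] and [eta_max], with weights [(1 - c) / 2] and
    [(1 + c) / 2]. *)
Lemma lr_cosine_itv {R : realType} (eta_min eta_max : R) T t :
  0 <= eta_min -> eta_min <= eta_max ->
  0 <= lr_cosine eta_min eta_max T t <= eta_max.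
Proof.
move=> min_ge0 min_le; rewrite /lr_cosine.
move: (cos_geN1 (t%:R / T%:R * pi : R)) (cos_le1 (t%:R / T%:R * pi : R)).
move: (cos _) => c c1 c2.
have h1 : 0 <= (eta_max - eta_min) * (1 + c) by apply: mulr_ge0; lra.
have h2 : 0 <= (eta_max - eta_min) * (1 - c) by apply: mulr_ge0; lra.
by apply/andP; split; nra.
Qed.

(** In the first half the angle lies in [[0, pi / 2]], so the cosine is nonnegative and the rate is
    at least the midpoint of [eta_min] and [eta_max]. *)
Lemma lr_cosine_ge {R : realType} (eta_min eta_max : R) T t :
  0 <= eta_min -> eta_min <= eta_max -> (t.*2 <= T)%N ->
  eta_max / 2 <= lr_cosine eta_min eta_max T t.
Proof.
move=> min_ge0 min_le tT; rewrite /lr_cosine.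
have : 0 <= cos (t%:R / T%:R * pi : R).
  have t0 : 0 <= t%:R / T%:R :> R by rewrite divr_ge0.
  have t1 : t%:R / T%:R <= 2^-1 :> R.
    (* For [T = 0] the quotient is 0 by the convention on inverses. *)
    case: T tT {t0} => [|T] tT; first by rewrite invr0 mulr0 invr_ge0.
    by rewrite ler_pdivrMr ?ltr0n// ler_pdivlMl// -natrM ler_nat mul2n.
  have pi0 := pi_gt0 R.
  by apply: cos_ge0_pihalf; apply/andP; split; nra.
by nra.
Qed.

Lemma powR_le1 {R : realType} (a p : R) :
  0 <= a -> a <= 1 -> 0 <= p -> a `^ p <= 1.
Proof.
move=> a0 a1 p0; apply: (@le_trans _ _ (1 `^ p)); last by rewrite powR1.
by rewrite ge0_ler_powR// nnegrE.
Qed.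

Lemma lr_polynomial_itv {R : realType} (eta_min eta_max p : R) T t :
  0 <= eta_min -> eta_min <= eta_max -> 0 < p -> (t < T)%N ->
  0 <= lr_polynomial eta_min eta_max p T t <= eta_max.
Proof.
move=> min_ge0 min_le p_gt0 tT; rewrite /lr_polynomial.
have T0 : 0 < T%:R :> R by rewrite ltr0n; case: T tT.
have s0 : 0 <= 1 - t%:R / T%:R :> R.
  by rewrite subr_ge0 ler_pdivrMr// mul1r ler_nat ltnW.
have s1 : 1 - t%:R / T%:R <= 1 :> R by rewrite gerBl divr_ge0.
have q0 := powR_ge0 (1 - t%:R / T%:R) p.
have q1 : (1 - t%:R / T%:R) `^ p <= 1.
  by rewrite powR_le1// ltW.
by apply/andP; split; nra.
Qed.

Lemma lr_polynomial_ge {R : realType} (eta_min eta_max p : R) T t :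
  0 <= eta_min -> eta_min <= eta_max -> 0 < p -> (t < T)%N -> (t.*2 <= T)%N ->
  2^-1 `^ p * eta_max <= lr_polynomial eta_min eta_max p T t.
Proof.
move=> min_ge0 min_le p_gt0 tT t2T; rewrite /lr_polynomial.
have T0 : 0 < T%:R :> R by rewrite ltr0n; case: T tT {t2T}.
have s0 : 2^-1 <= 1 - t%:R / T%:R :> R.
  have : t%:R / T%:R <= 2^-1 :> R.
    by rewrite ler_pdivrMr// ler_pdivlMl// -natrM ler_nat mul2n.
  lra.
have : 2^-1 `^ p <= (1 - t%:R / T%:R) `^ p.
  rewrite ge0_ler_powR ?nnegrE ?invr_ge0//; first exact: ltW.
  by apply: le_trans s0; rewrite invr_ge0.
have : 2^-1 `^ p <= 1 :> R.
  by rewrite powR_le1 ?invr_ge0 ?invf_le1 ?ler1n// ltW.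
have := powR_ge0 (2^-1 : R) p.
by nra.
Qed.

Lemma sum_inv_le_ln {R : realType} (T : nat) : (0 < T)%N ->
  \sum_(t < T) t.+1%:R^-1 <= 1 + ln T%:R :> R.
Proof.
case: T => // T _; elim: T => [|T IHT].
  by rewrite big_ord1 invr1 ln1 addr0.
rewrite big_ord_recr/=.
suff step_le : T.+2%:R^-1 <= ln T.+2%:R - ln T.+1%:R :> R.
  by apply: (le_trans (lerD IHT step_le)); rewrite addrA addrAC addrK.
(* The inequality [ln (1 - y) <= - y] at [y = 1 / (T + 2)] bounds one harmonic term by a difference
   of logarithms. *)
have := @le_ln1Dx R (- T.+2%:R^-1).
rewrite ltrN2 invf_lt1 ?ltr0n// ltr1n => /(_ isT).
have -> : 1 - T.+2%:R^-1 = T.+1%:R / T.+2%:R :> R.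
  by rewrite -[T.+1%:R](addrK 1) natr1 mulrBl divff ?pnatr_eq0// mul1r.
by rewrite ln_div ?posrE ?ltr0n// -opprB lerNr opprK.
Qed.

(** Each of the [T] terms is at least the bound [eta_max / sqrt T]. *)
Lemma sum_lr_diminishing_ge {R : realType} (eta_max : R) T : (0 < T)%N ->
  0 <= eta_max ->
  eta_max * Num.sqrt T%:R <= \sum_(t < T) lr_diminishing eta_max T t.
Proof.
move=> T0 e0; have sT : 0 < Num.sqrt T%:R :> R by rewrite sqrtr_gt0 ltr0n.
have -> : eta_max * Num.sqrt T%:R = \sum_(t < T) eta_max / Num.sqrt T%:R.
  have TT : T%:R = Num.sqrt T%:R * Num.sqrt T%:R :> R.
    by rewrite -expr2 sqr_sqrtr.
  rewrite sumr_const card_ord -[RHS]mulr_natr -mulrA {3}TT mulKf//.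
  by rewrite gt_eqF.
apply: ler_sum => t _; rewrite /lr_diminishing ler_wpM2l// lef_pV2 ?posrE//.
  by rewrite ler_sqrt ?ltr0n// ler_nat.
Qed.

Lemma sum_sq_lr_diminishing_le {R : realType} (eta_max : R) T : (0 < T)%N ->
  \sum_(t < T) lr_diminishing eta_max T t ^+ 2 <= eta_max ^+ 2 * (1 + ln T%:R).
Proof.
move=> T0; have -> : \sum_(t < T) lr_diminishing eta_max T t ^+ 2 =
    eta_max ^+ 2 * \sum_(t < T) t.+1%:R^-1.
  by rewrite mulr_sumr; apply: eq_bigr => t _;
    rewrite /lr_diminishing expr_div_n sqr_sqrtr.
by rewrite ler_wpM2l ?sqr_ge0// sum_inv_le_ln.
Qed.

Lemma lr_diminishing_itv {R : realType} (eta_max : R) T t : 0 <= eta_max ->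
  0 <= lr_diminishing eta_max T t <= eta_max.
Proof.
move=> e0; rewrite /lr_diminishing divr_ge0 ?sqrtr_ge0//=.
rewrite ler_pdivrMr ?sqrtr_gt0 ?ltr0n// ler_peMr//.
by rewrite -[leLHS]sqrtr1 ler_sqrt ?ltr0n// ler1n.
Qed.

(** * From sums of learning rates to the stated rates *)

Lemma average_bounded_below {R : realType} {n : nat}
    {M : riemannianManifold R n} {N : nat} {fs : 'I_N -> M -> R} :
  (forall j, bounded_below (fs j)) -> bounded_below (average fs).
Proof.
move=> /choice[c c_le]; exists (N%:R^-1 * \sum_j c j) => x.
by rewrite /average ler_wpM2l ?invr_ge0//; apply: ler_sum => j _; exact: c_le.
Qed.

(** The 1 in [1 + logT] goes into the first constant by [invb <= 1]; this keeps that constant free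
    of the batch size, which remains only beside the logarithm. *)
Lemma diminishing_bound {R : realType}
    (Delta L s emax kappa S S2 T invb logT : R) :
  0 <= Delta -> 0 < L -> 0 < emax -> 0 < kappa -> 0 < T -> 0 <= logT ->
  0 <= s -> 0 <= invb <= 1 -> 0 <= S2 ->
  emax * Num.sqrt T <= S -> S2 <= emax ^+ 2 * (1 + logT) ->
  (Delta + L / 2 * (s * invb) * S2) / (kappa * S) <=
  ((Delta + L / 2 * s * emax ^+ 2) / (kappa * emax) +
    L / 2 * emax / kappa * s * invb * logT) / Num.sqrt T.
Proof.
move=> D0 L0 e0 k0 T0 l0 s0 /andP[b0 b1] S2_ge0 S_ge S2_le.
have sT : 0 < Num.sqrt T by rewrite sqrtr_gt0.
have S0 : 0 < S by apply: lt_le_trans S_ge; rewrite mulr_gt0.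
have Ls0 : 0 <= L / 2 * s by rewrite mulr_ge0// divr_ge0// ltW.
have -> : ((Delta + L / 2 * s * emax ^+ 2) / (kappa * emax) +
    L / 2 * emax / kappa * s * invb * logT) / Num.sqrt T =
  (Delta + L / 2 * s * emax ^+ 2 + L / 2 * (s * invb) * (emax ^+ 2 * logT)) /
    (kappa * (emax * Num.sqrt T)).
  by field; rewrite !gt_eqF.
have num_le : Delta + L / 2 * (s * invb) * S2 <=
    Delta + L / 2 * s * emax ^+ 2 + L / 2 * (s * invb) * (emax ^+ 2 * logT).
  rewrite -addrA lerD2l.
  apply: (@le_trans _ _ (L / 2 * (s * invb) * (emax ^+ 2 * (1 + logT)))).
    by rewrite ler_wpM2l// mulrA mulr_ge0.
  rewrite mulrDr mulr1 mulrDr lerD2r ler_wpM2r ?sqr_ge0//.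
  by rewrite mulrA ler_piMr.
apply: ler_pM => //.
- by rewrite addr_ge0// mulr_ge0// mulrA mulr_ge0.
- by rewrite invr_ge0 mulr_ge0 ?ltW.
- by rewrite lef_pV2 ?posrE ?mulr_gt0// ler_wpM2l// ltW.
Qed.

(** The linear growth of [S] is used for the [Delta] part only; in the noise part [S2 <= emax * S]
    cancels [S] and leaves a term constant in [T]. *)
Lemma floor_bound {R : realType} (Delta L s emax kappa S S2 T a invb : R) :
  0 <= Delta -> 0 < L -> 0 < emax -> 0 < kappa -> 0 < T -> 0 < a ->
  0 <= s -> 0 <= invb ->
  a / 2 * T <= S -> S2 <= emax * S ->
  (Delta + L / 2 * (s * invb) * S2) / (kappa * S) <=
  (Delta / (kappa * (a / 2))) / T + (L / 2 * emax / kappa) * s * invb.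
Proof.
move=> D0 L0 e0 k0 T0 a0 s0 b0 S_ge S2_le.
have aT : 0 < a / 2 * T by rewrite mulr_gt0 ?divr_gt0.
have S0 : 0 < S by exact: lt_le_trans S_ge.
have Ls0 : 0 <= L / 2 * (s * invb).
  by rewrite !mulr_ge0 ?invr_ge0// ltW.
rewrite mulrDl lerD//.
  have -> : Delta / (kappa * (a / 2)) / T = Delta / (kappa * (a / 2 * T)).
    by field; rewrite !gt_eqF.
  by rewrite ler_wpM2l// lef_pV2 ?posrE ?mulr_gt0 ?divr_gt0// ler_wpM2l// ltW.
rewrite ler_pdivrMr ?mulr_gt0//.
have -> : L / 2 * emax / kappa * s * invb * (kappa * S) =
    L / 2 * (s * invb) * (emax * S) by field; rewrite gt_eqF.
by rewrite ler_wpM2l.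
Qed.

Lemma bigO_affine_log {R : realType} (a c : R) :
  (fun T : nat => (a + c * ln T%:R) / Num.sqrt T%:R) =O_\oo
  (fun T : nat => ln T%:R / Num.sqrt T%:R).
Proof.
(* The summand 1 makes the constant positive even if [a] and [c] vanish. *)
apply/eqO_exP; exists (`|a| + `|c| + 1); first by rewrite ltr_wpDl// addr_ge0.
near=> T.
(* From [T >= e] on the logarithm is at least 1, so it dominates the constant term. *)
have T_ge : expR 1 <= T%:R :> R by near: T; exact: nbhs_infty_ger.
have log_ge1 : 1 <= ln T%:R :> R.
  rewrite -[leLHS](@expRK R) ler_ln ?posrE ?expR_gt0//.
  exact: lt_le_trans (expR_gt0 _) T_ge.
rewrite !normrM mulrA ler_wpM2r ?normr_ge0//.
have log_norm : `|ln T%:R| = ln T%:R :> R.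
  by rewrite ger0_norm// (le_trans ler01).
apply: (le_trans (ler_normD _ _)); rewrite normrM log_norm.
have := normr_ge0 a; have := normr_ge0 c.
move: (`|a|) (`|c|) log_ge1 => u v log_ge1 v0 u0.
by nra.
Unshelve. all: by end_near.
Qed.

Theorem theorem5 (R : realType) (n : nat) (M : riemannianManifold R n)
    (Rt : forall x : M, tangent x -> M)
    (N : nat) (fs : 'I_N -> M -> R) (Pi : 'I_N -> R)
    (Lr sigma eta_min eta_max p : R) (x0 : M)
    (d : measure_display) (Omega : measurableType d) (P : probability Omega R)
    (xi : nat * nat -> Omega -> 'I_N) :
  retraction Rt ->
  (forall j, smooth_fun (fs j)) ->
  (forall j, bounded_below (fs j)) ->
  0 < Lr -> retraction_smooth Rt (average fs) Lr ->
  0 < sigma -> bounded_variance fs Pi sigma ->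
  0 <= eta_min -> eta_min <= eta_max -> eta_max < 2 / Lr -> 0 < eta_max ->
  0 < p ->
  iid_samples P Pi xi ->
  let min_sq_grad_of (lr : nat -> nat -> R) (T b : nat) : \bar R :=
    min_sq_grad (average fs) P
      (rsgd Rt fs (lr T) (fun _ => b) xi x0) T in
  exists Q1 Q2 Qt1 Qt2 : R,
    let bound_dim (T b : nat) : R :=
      (Q1 + Q2 * sigma ^+ 2 * b%:R^-1 * ln T%:R) / Num.sqrt T%:R in
    let bound (T b : nat) : R :=
      Qt1 / T%:R + Qt2 * sigma ^+ 2 / b%:R in
    [/\ forall T b : nat, (0 < T)%N -> (0 < b)%N ->
          (min_sq_grad_of (lr_diminishing eta_max) T b
             <= (bound_dim T b)%:E)%E,
        forall b : nat, (0 < b)%N ->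
          bound_dim ^~ b =O_\oo (fun T => ln T%:R / Num.sqrt T%:R),
        forall lr : nat -> nat -> R,
          [\/ lr = lr_constant eta_max,
              lr = lr_cosine eta_min eta_max |
              lr = lr_polynomial eta_min eta_max p] ->
          forall T b : nat, (0 < T)%N -> (0 < b)%N ->
            (min_sq_grad_of lr T b <= (bound T b)%:E)%E &
        exists C : R, forall T b : nat, (0 < T)%N -> (0 < b)%N ->
          `|bound T b| <= C * (T%:R^-1 + b%:R^-1)].
Proof.
move=> _ _ fs_lb Lr_gt0 smooth sigma_gt0 variance min_ge0 min_le max_lt max_gt0.
move=> p_gt0 iid min_sq_grad_of.
have [lb f_ge] := average_bounded_below fs_lb.
pose Delta := average fs x0 - lb.
have Delta_ge0 : 0 <= Delta by rewrite subr_ge0.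
pose kappa := 1 - Lr / 2 * eta_max.
have kappa_gt0 : 0 < kappa.
  by move: max_lt; rewrite /kappa ltr_pdivlMr// => max_lt; lra.
pose q : R := 2^-1 `^ p.
have q_gt0 : 0 < q by rewrite powR_gt0// invr_gt0.
have q_le1 : q <= 1 by rewrite powR_le1 ?invr_ge0 ?invf_le1 ?ler1n// ltW.
(* A common lower bound in the first half: it is below [eta_max], [eta_max / 2] and [q * eta_max],
   the bounds for the constant, cosine and polynomial rates. *)
pose a := q * (eta_max / 2).
have a_gt0 : 0 < a by rewrite mulr_gt0// divr_gt0.
have s_ge0 : 0 <= sigma ^+ 2 by exact: sqr_ge0.
have invb_itv (b : nat) : (0 < b)%N -> 0 <= (b%:R^-1 : R) <= 1.
  by move=> b0; rewrite invr_ge0 ler0n/= invf_le1 ?ltr0n// ler1n.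
(* The constants delivered by [diminishing_bound] and [floor_bound]; none involves [T] or [b]. *)
exists ((Delta + Lr / 2 * sigma ^+ 2 * eta_max ^+ 2) / (kappa * eta_max)),
  (Lr / 2 * eta_max / kappa), (Delta / (kappa * (a / 2))),
  (Lr / 2 * eta_max / kappa).
move=> bound_dim bound; split.
- move=> T b T0 b0.
  have S_ge := sum_lr_diminishing_ge eta_max T T0 (ltW max_gt0).
  have sqrtT_gt0 : 0 < Num.sqrt T%:R :> R by rewrite sqrtr_gt0 ltr0n.
  apply: (le_trans (min_sq_grad_rsgd Lr_gt0 smooth variance b0 iid f_ge
    (lr_diminishing eta_max T) eta_max T _ max_lt _)).
  + by move=> t _; rewrite lr_diminishing_itv// ltW.
  + by apply: lt_le_trans S_ge; rewrite mulr_gt0.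
  rewrite lee_fin; apply: diminishing_bound => //.
  + by rewrite ltr0n.
  + by rewrite ln_ge0// ler1n.
  + exact: invb_itv.
  + by apply: sumr_ge0 => t _; exact: sqr_ge0.
  + exact: sum_sq_lr_diminishing_le.
- move=> b _; rewrite /bound_dim; exact: bigO_affine_log.
- move=> lr lr_cases T b T0 b0.
  have lr_itv t : (t < T)%N -> 0 <= lr T t <= eta_max.
    move=> tT; case: lr_cases => ->.
    + by rewrite /lr_constant lexx ltW.
    + exact: lr_cosine_itv.
    + exact: lr_polynomial_itv.
  have lr_ge t : (t < T)%N -> (t.*2 <= T)%N -> a <= lr T t.
    move=> tT t2T; case: lr_cases => ->.
    + by rewrite /lr_constant /a; nra.
    + apply: le_trans (lr_cosine_ge _ _ _ _ min_ge0 min_le t2T).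
      by rewrite /a ler_piMl// divr_ge0// ltW.
    + apply: le_trans (lr_polynomial_ge _ _ _ _ _ min_ge0 min_le p_gt0 tT t2T).
      by rewrite /a ler_wpM2l ?ltW//; lra.
  have S_ge : a / 2 * T%:R <= \sum_(t < T) lr T t.
    by apply: sum_ge_half => // t /lr_itv/andP[].
  have S2_le : \sum_(t < T) lr T t ^+ 2 <= eta_max * \sum_(t < T) lr T t.
    rewrite mulr_sumr; apply: ler_sum => t _.
    by have /andP[lr0 lr1] := lr_itv t (ltn_ord t); rewrite expr2 ler_wpM2r.
  apply: (le_trans (min_sq_grad_rsgd Lr_gt0 smooth variance b0 iid f_ge
    (lr T) eta_max T lr_itv max_lt _)).
    by apply: lt_le_trans S_ge; rewrite mulr_gt0 ?divr_gt0 ?ltr0n.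
  rewrite lee_fin; apply: floor_bound => //; by rewrite ltr0n.
- pose c1 := Delta / (kappa * (a / 2)).
  pose c2 := Lr / 2 * eta_max / kappa * sigma ^+ 2.
  exists (`|c1| + `|c2|) => T b _ _; rewrite /bound -/c1 -/c2.
  apply: (le_trans (ler_normD _ _)); rewrite !normrM mulrDr.
  have T0 : 0 <= T%:R^-1 :> R by rewrite invr_ge0.
  have b0 : 0 <= b%:R^-1 :> R by rewrite invr_ge0.
  rewrite (ger0_norm T0) (ger0_norm b0).
  by rewrite lerD// ler_wpM2r// ?lerDl ?lerDr.
Qed.
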